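(* Let $\alpha\in(0,1)$ be irrational with bounded partial quotients, and let $s_\alpha$ be a Sturmian word of angle $\alpha$. Then there exists a constant $C>0$ such that for every integer $n\ge2$, $\sum_{m\le n}\mathrm{as}_{s_\alpha}(m)\ge Cn^2$, where $\mathrm{as}_{s_\alpha}(m)$ is the number of distinct factors of $s_\alpha$ of length $m$ that are abelian squares.
   Context: $\{x\}=x-\lfloor x\rfloor$. For $\alpha\in(0,1)$ irrational and $\rho\in[0,1)$, the Sturmian word $s_{\alpha,\rho}=a_0a_1\cdots$ over $\{a,b\}$ has $a_m=b$ if $\{\rho+m\alpha\}\in[0,1-\alpha)$ and $a_m=a$ otherwise (or the variant with intervals $(0,1-\alpha]$ and $(1-\alpha,1]$); its set of factors depends only on $\alpha$, and any such word is a Sturmian word of angle $\alpha$. An abelian square is a nonempty word $uv$ where $v$ is an anagram of $u$. $\alpha=[a_0;a_1,\ldots]$ has bounded partial quotients if $(a_i)$ is bounded. *)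

(* Defs.v *)
From HB Require Import structures.
From mathcomp Require Import all_boot all_order all_algebra.
From mathcomp Require Import all_classical all_reals.

Set Implicit Arguments.
Unset Strict Implicit.
Unset Printing Implicit Defensive.

Import Order.TTheory GRing.Theory Num.Theory.
Local Open Scope ring_scope.

Inductive letter := La | Lb.

Definition bool_of_letter (x : letter) : bool := if x is La then true else false.
Definition letter_of_bool (x : bool) : letter := if x then La else Lb.

Lemma bool_of_letterK : cancel bool_of_letter letter_of_bool.
Proof. by case. Qed.

HB.instance Definition _ := Countable.copy letter (can_type bool_of_letterK).
HB.instance Definition _ : isFinite letter := CanIsFinite bool_of_letterK.

Definition factor (s : nat -> letter) (w : seq letter) : Prop :=
  exists i : nat, w = mkseq (fun j => s (i + j)%N) (size w).

Definition abelian_square (w : seq letter) : Prop :=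
  exists u v : seq letter, [/\ w = u ++ v, w != [::] & perm_eq u v].

Definition as_count (s : nat -> letter) (m : nat) : nat :=
  #|[set w : m.-tuple letter | `[< factor s w /\ abelian_square w >]]%SET|.

Definition fracpart (R : realType) (x : R) : R := x - (Num.floor x)%:~R.

Definition sturmian (R : realType) (alpha rho : R) (m : nat) : letter :=
  let x := fracpart (rho + m%:R * alpha) in
  if (0 <= x) && (x < 1 - alpha) then Lb else La.

(* The intervals are (0, 1 - alpha] and (1 - alpha, 1]: they partition the
   circle R/Z with 0 identified with 1, so that fractional part 0 falls in the
   second one. *)
Definition sturmian' (R : realType) (alpha rho : R) (m : nat) : letter :=
  let x := fracpart (rho + m%:R * alpha) in
  if (0 < x) && (x <= 1 - alpha) then Lb else La.

Definition sturmian_of_angle (R : realType) (alpha : R) (s : nat -> letter)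
    : Prop :=
  exists rho : R, [/\ 0 <= rho, rho < 1 &
    s =1 sturmian alpha rho \/ s =1 sturmian' alpha rho].

(* Complete quotients of the continued fraction expansion
   x = [a_0; a_1, a_2, ...]: x_0 = x and x_{i+1} = 1 / {x_i}, a_i being the
   integer part of x_i. For irrational x, {x_i} never vanishes. *)
Fixpoint complete_quotient (R : realType) (x : R) (i : nat) : R :=
  if i is j.+1 then (fracpart (complete_quotient x j))^-1 else x.

Definition partial_quotient (R : realType) (x : R) (i : nat) : int :=
  Num.floor (complete_quotient x i).

Definition bounded_partial_quotients (R : realType) (x : R) : Prop :=
  exists M : int, forall i : nat, `|partial_quotient x i| <= M.

(* Main.v *)
Require Import Defs.
From mathcomp Require Import all_boot all_order all_algebra.
From mathcomp Require Import all_classical all_reals.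
From mathcomp Require Import zify ring lra.

(** Let A i be the floor of rho + i alpha (or its ceiling minus 1), so that the
    block of length m at position i has A (i + m) - A i letters a. If
    0 < {m alpha} < 1/4 and 0 < {rho + i alpha} < 1/4, the two halves of the
    block of length 2m at i have the same number of letters a. Two blocks of
    length 2m are distinct as soon as a point p_j = {- j alpha}, j < 2m,
    separates the positions {rho + i alpha} where they start. The irrational
    rotation visits (0, 1/4) with bounded return time L, so at least 2m / L
    points p_j lie in (0, 1/4); starting a block just to the right of each of
    them yields 2m / L distinct abelian squares, for at least one m in every
    window of length L. *)

Set Implicit Arguments.
Unset Strict Implicit.
Unset Printing Implicit Defensive.

Import Order.TTheory GRing.Theory Num.Theory.
Local Open Scope ring_scope.

(** * Irrational rotations: approximation and bounded return times *)

Lemma irrational_neq_frac (R : realType) (x : R) (a : int) (b : nat) :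
  irrational x -> (0 < b)%N -> b%:R * x != a%:~R.
Proof.
move=> irr b_gt0; apply/eqP => bx; apply: irr.
apply/rationalP; exists a, b; rewrite -bx mulrC mulKf //.
by rewrite pnatr_eq0 -lt0n.
Qed.

Lemma fracpart_ge0_lt1 (R : realType) (x : R) : 0 <= fracpart x < 1.
Proof.
have := floor_itv x; rewrite /fracpart intrD.
by move=> /andP[? ?]; apply/andP; split; lra.
Qed.

(** Pigeonhole: [N + 1] points of the orbit fall into [N] boxes of width [1 / N < eps], so two share
    a box. Their difference is nonzero by irrationality. *)
Lemma dirichlet_approx (R : realType) (alpha eps : R) :
    irrational alpha -> 0 < eps ->
  exists (q : nat) (p : int),
    q%:R * alpha - p%:~R != 0 /\ `|q%:R * alpha - p%:~R| < eps.
Proof.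
move=> irr eps_gt0.
pose N := (Num.truncn eps^-1).+1.
have epsN : eps^-1 < N%:R by rewrite truncnS_gt.
have N_gt0 : 0 < N%:R :> R by rewrite ltr0n.
have bucket_lt (i : 'I_N.+1) :
    (`|Num.floor (N%:R * fracpart (i%:R * alpha))| < N)%N.
  have /andP[x_ge0 x_lt1] := fracpart_ge0_lt1 (i%:R * alpha).
  have : 0 <= N%:R * fracpart (i%:R * alpha) by rewrite mulr_ge0 ?ler0n.
  have : N%:R * fracpart (i%:R * alpha) < (N%:Z)%:~R by rewrite gtr_pMr.
  by rewrite -floor_lt_int -floor_ge0; case: (Num.floor _) => z; rewrite ?ltz_nat.
pose bucket i := Ordinal (bucket_lt i).
have /injectivePn[i [j ij bucket_ij]] : ~~ injectiveb bucket.
  by apply/injectiveP => /leq_card; rewrite !card_ord ltnn.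
wlog lt_ij : i j ij bucket_ij / (i < j)%N.
  move=> wl; case: (ltngtP i j) => [|lt_ji|eq_ij]; first exact: wl.
  - by apply: (wl j i) => //; rewrite eq_sym.
  - by case/eqP: ij; apply: val_inj.
have floor_eq : Num.floor (N%:R * fracpart (i%:R * alpha))
              = Num.floor (N%:R * fracpart (j%:R * alpha)).
  have := congr1 (fun k : 'I_N => nat_of_ord k) bucket_ij => /= abs_eq.
  have /andP[xi _] := fracpart_ge0_lt1 (i%:R * alpha).
  have /andP[xj _] := fracpart_ge0_lt1 (j%:R * alpha).
  have floor_i : 0 <= Num.floor (N%:R * fracpart (i%:R * alpha)).
    by rewrite floor_ge0 mulr_ge0.
  have floor_j : 0 <= Num.floor (N%:R * fracpart (j%:R * alpha)).
    by rewrite floor_ge0 mulr_ge0.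
  by rewrite -(gez0_abs floor_i) -(gez0_abs floor_j) abs_eq.
exists (j - i)%N, (Num.floor (j%:R * alpha) - Num.floor (i%:R * alpha)).
split.
  by rewrite subr_eq0 irrational_neq_frac// subn_gt0.
have -> : (j - i)%:R * alpha
    - (Num.floor (j%:R * alpha) - Num.floor (i%:R * alpha))%:~R
    = fracpart (j%:R * alpha) - fracpart (i%:R * alpha).
  by rewrite /fracpart natrB 1?ltnW // intrB; ring.
have : `|N%:R * (fracpart (j%:R * alpha) - fracpart (i%:R * alpha))| < 1.
  rewrite mulrBr.
  have := floor_itv (N%:R * fracpart (i%:R * alpha)).
  have := floor_itv (N%:R * fracpart (j%:R * alpha)).
  rewrite floor_eq intrD ltr_norml => /andP[? ?] /andP[? ?].
  by apply/andP; split; lra.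
rewrite normrM (gtr0_norm N_gt0) mulrC -ltr_pdivlMr // mul1r => /lt_trans.
by apply; rewrite invf_plt.
Qed.

(** Steps shorter than the interval cannot jump over it, and a start at most 1 below [a] reaches it
    within [K > 1 / d] steps. *)
Lemma exists_multiple_in_interval (R : realType) (d a b : R) (K : nat) (y : R) :
    0 < d < b - a -> d^-1 < K%:R -> a - 1 <= y <= a ->
  exists2 k : nat, (k <= K)%N & a < y + k%:R * d < b.
Proof.
move=> /andP[d_gt0 d_lt] dK /andP[y_ge y_le].
have t_ge0 : 0 <= (a - y) / d by rewrite divr_ge0 ?subr_ge0 // ltW.
have /andP[trunc_le trunc_lt] := truncn_itv t_ge0.
set k := Num.truncn _ in trunc_le trunc_lt.
have t_lt : (a - y) / d < K%:R.
  apply: le_lt_trans dK.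
  by rewrite ler_pdivrMr // mulVf ?gt_eqF //; lra.
exists k.+1.
  by rewrite -(ltr_nat R); apply: le_lt_trans t_lt.
move: trunc_le trunc_lt; rewrite ler_pdivlMr // ltr_pdivrMr // => le1 lt1.
apply/andP; split; first by lra.
by move: lt1; rewrite -natr1 mulrDl; lra.
Qed.

(** Moving [q] indices at a time shifts the orbit by the small step [d] modulo 1. The number of such
    steps needed depends only on [d], so [L] is uniform in [x]. *)
Lemma rotation_bounded_return (R : realType) (alpha a b : R) :
    irrational alpha -> a < b ->
  exists2 L : nat, (0 < L)%N & forall x : R,
    exists (i : nat) (k : int), (i < L)%N /\ a < x + i%:R * alpha - k%:~R < b.
Proof.
move=> irr ab; have eps_gt0 : 0 < b - a by rewrite subr_gt0.
have [q [p [d_neq0 d_lt]]] := @dirichlet_approx R alpha _ irr eps_gt0.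
set d := q%:R * alpha - p%:~R in d_neq0 d_lt.
pose K := (Num.truncn `|d|^-1).+1.
have dK : `|d|^-1 < K%:R by rewrite truncnS_gt.
exists (K * q).+1 => // x.
case: (ltgtP d 0) d_neq0 => // d_sign _.
- rewrite ltr0_norm // in d_lt dK.
  (* The orbit drifts to the left here, so the picture is reflected: [x] is first translated by an
     integer into [[b, b + 1)], then negated. *)
  have [k kK] : exists2 k : nat, (k <= K)%N &
      - b < (- (x - b - (Num.floor (x - b))%:~R) - b) + k%:R * - d < - a.
    apply: (@exists_multiple_in_interval _ (- d) (- b) (- a) K) => //.
      by apply/andP; split; lra.
    have := floor_itv (x - b); rewrite intrD => /andP[? ?].
    by apply/andP; split; lra.
  move=> /andP[? ?]; exists (k * q)%N, (Num.floor (x - b) + k%:Z * p); split.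
    by rewrite ltnS leq_mul2r kK orbT.
  have -> : x + (k * q)%:R * alpha - (Num.floor (x - b) + k%:Z * p)%:~R
          = x - (Num.floor (x - b))%:~R + k%:R * d.
    by rewrite /d natrM intrD intrM; ring.
  by apply/andP; split; lra.
- rewrite gtr0_norm // in d_lt dK.
  have [k kK] : exists2 k : nat, (k <= K)%N &
      a < (x - a - (Num.floor (x - a))%:~R - 1 + a) + k%:R * d < b.
    apply: (@exists_multiple_in_interval _ d a b K) => //; first exact/andP.
    have := floor_itv (x - a); rewrite intrD => /andP[? ?].
    by apply/andP; split; lra.
  move=> /andP[? ?]; exists (k * q)%N, (Num.floor (x - a) + 1 + k%:Z * p); split.
    by rewrite ltnS leq_mul2r kK orbT.
  have -> : x + (k * q)%:R * alpha - (Num.floor (x - a) + 1 + k%:Z * p)%:~R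
          = x - (Num.floor (x - a))%:~R - 1 + k%:R * d.
    by rewrite /d natrM !intrD intrM; ring.
  by apply/andP; split; lra.
Qed.

(** * Sums over blocks of indices *)

Lemma sum_block_lower_bound (f g : nat -> nat) (L T : nat) :
    (forall t, exists2 m, (t * L <= m < t.+1 * L)%N & (g t <= f m)%N) ->
  (\sum_(0 <= t < T) g t <= \sum_(0 <= m < T * L) f m)%N.
Proof.
move=> blocks; elim: T => [|T IH]; first by rewrite big_geq.
rewrite big_nat_recr //= [leqRHS](@big_cat_nat _ _ _ (T * L)) //=; last first.
  by rewrite leq_mul2r leqnSn orbT.
apply: leq_add => //; have [m m_in /leq_trans] := blocks T; apply.
by rewrite (bigD1_seq m) ?mem_index_iota ?iota_uniq //= leq_addr.
Qed.

Lemma sum_even_le (f : nat -> nat) (K : nat) :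
  (\sum_(0 <= k < K) f k.*2 <= \sum_(0 <= m < K.*2) f m)%N.
Proof.
elim: K => [|K IH]; first by rewrite big_geq.
by rewrite doubleS !big_nat_recr //=; lia.
Qed.

(** * Heights of Sturmian words and comparison of factors *)

(* The weak inequalities cover both A i = floor (rho + i alpha) and
   A i = ceil (rho + i alpha) - 1, that is, both kinds of Sturmian words. *)
Definition height (R : realType) (alpha rho : R) (s : nat -> letter)
    (A : nat -> int) : Prop :=
  (forall i, (A i)%:~R <= rho + i%:R * alpha <= (A i)%:~R + 1) /\
  (forall i, A i.+1 = A i + (s i == La)%:Z).

Lemma sturmian_height (R : realType) (alpha : R) (s : nat -> letter) :
    0 < alpha < 1 -> sturmian_of_angle alpha s ->
  exists rho A, height alpha rho s A.
Proof.
move=> /andP[a_gt0 a_lt1] [rho [_ _ sE]].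
have step i : rho + i.+1%:R * alpha = rho + i%:R * alpha + alpha.
  by rewrite -natr1; ring.
have Lb_neq_La : (Lb == La) = false by [].
exists rho; case: sE => sE.
- exists (fun i => Num.floor (rho + i%:R * alpha)); split=> i.
    have := floor_itv (rho + i%:R * alpha); rewrite intrD => /andP[? ?].
    by apply/andP; split; lra.
  rewrite sE /sturmian step /fracpart; set x := rho + _.
  have := floor_itv x; rewrite intrD => /andP[? ?].
  have [xP|xP] := boolP (_ && _); apply: floor_def;
    rewrite ?eqxx ?Lb_neq_La !intrD /=; apply/andP; split; move: xP; lra.
- exists (fun i => Num.ceil (rho + i%:R * alpha) - 1); split=> i.
    have := ceil_itv (rho + i%:R * alpha); rewrite intrB => /andP[? ?].
    by apply/andP; split; lra.
  rewrite sE /sturmian' step /fracpart; set x := rho + _.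
  rewrite [RHS]addrAC; congr (_ - 1); apply: ceil_def.
  have := floor_itv x; have := ceil_itv x; rewrite !intrD => /andP[? ?] /andP[? ?].
  (* At an integer [x] the letter is [La] and floor and ceiling agree; elsewhere they differ by
     1. *)
  have [xf|xf] := eqVneq x (Num.floor x)%:~R.
    have -> : Num.ceil x = Num.floor x by rewrite xf intrKceil intrKfloor.
    have -> : x - (Num.floor x)%:~R = 0 by rewrite {1}xf subrr.
    by rewrite ltxx /=; apply/andP; split; lra.
  have -> : Num.ceil x = Num.floor x + 1.
    apply: ceil_def; rewrite addrK intrD lt_neqAle eq_sym xf /=.
    by apply/andP; split; lra.
  have floor_lt : (Num.floor x)%:~R < x by rewrite lt_neqAle eq_sym xf /=.
  rewrite intrD; case: ifP => xP; rewrite ?eqxx ?Lb_neq_La /=;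
    by apply/andP; split; move: xP; lra.
Qed.

Lemma height_eq (R : realType) (alpha rho : R) (s : nat -> letter)
    (A : nat -> int) (i : nat) (c : int) :
    height alpha rho s A -> c%:~R < rho + i%:R * alpha < c%:~R + 1 ->
  A i = c.
Proof.
move=> [/(_ i)/andP[le_A A_le] _] /andP[? ?].
have /[!ltr_int] : (A i)%:~R < (c + 1)%:~R :> R by rewrite intrD; lra.
have /[!ltr_int] : c%:~R < (A i + 1)%:~R :> R by rewrite intrD; lra.
by lia.
Qed.

Lemma height_count (R : realType) (alpha rho : R) (s : nat -> letter)
    (A : nat -> int) (i m : nat) :
    height alpha rho s A ->
  A (i + m)%N = A i + (count_mem La (mkseq (fun j => s (i + j)%N) m))%:Z.
Proof.
move=> [_ AS]; elim: m => [|m IH]; first by rewrite addn0 addr0.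
by rewrite addnS AS IH mkseqS -cats1 count_cat /= addn0 PoszD addrA.
Qed.

Lemma perm_eq_letters (u v : seq letter) :
  size u = size v -> count_mem La u = count_mem La v -> perm_eq u v.
Proof.
move=> size_uv countLa; apply/allP => -[] _ /=; first by rewrite countLa.
have Lb_count (w : seq letter) : count_mem Lb w = (size w - count_mem La w)%N.
  rewrite -(count_predC (pred1 La)) addKn; apply: eq_count; by case.
by rewrite !Lb_count size_uv countLa.
Qed.

Lemma height_abelian_square (R : realType) (alpha rho : R)
    (s : nat -> letter) (A : nat -> int) (i m : nat) :
    height alpha rho s A -> (0 < m)%N ->
    A (i + m.*2)%N - A (i + m)%N = A (i + m)%N - A i ->
  abelian_square (mkseq (fun j => s (i + j)%N) m.*2).
Proof.
move=> hA m_gt0 A_eq.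
exists (mkseq (fun j => s (i + j)%N) m), (mkseq (fun j => s (i + m + j)%N) m).
split.
- rewrite -addnn /mkseq iotaD map_cat add0n; congr (_ ++ _).
  rewrite -[X in iota X _](addn0 m) iotaDl -map_comp.
  by apply: eq_map => j /=; rewrite addnA.
- by rewrite -size_eq0 size_mkseq double_eq0 -lt0n.
- apply: perm_eq_letters; first by rewrite !size_mkseq.
  have := height_count (i + m) m hA; have := height_count i m hA.
  by rewrite -addnA addnn; lia.
Qed.

Lemma mkseq_eq_height (R : realType) (alpha rho : R) (s : nat -> letter)
    (A : nat -> int) (i i' j N : nat) :
    height alpha rho s A -> (j <= N)%N ->
    mkseq (fun k => s (i + k)%N) N = mkseq (fun k => s (i' + k)%N) N ->
  A (i + j)%N - A i = A (i' + j)%N - A i'.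
Proof.
move=> hA le_jN words_eq; rewrite (height_count i j hA) (height_count i' j hA).
rewrite ![_ + _ - _]addrAC !subrr !add0r.
congr (Posz (count_mem La _)); apply/eq_in_map => k; rewrite mem_iota /= => lt_kj.
have lt_kN := leq_trans lt_kj le_jN.
by have := congr1 (fun w => nth La w k) words_eq; rewrite !nth_mkseq.
Qed.

(** After [j] more steps the left start is still below level [h] relative to [k], while the right
    one has passed [h] relative to [k']. The prefixes of length [j] thus contain fewer than [h] and
    at least [h] letters [La]. *)
Lemma height_separated (R : realType) (alpha rho : R) (s : nat -> letter)
    (A : nat -> int) (i i' j N : nat) (k k' h : int) :
    height alpha rho s A -> (j <= N)%N ->
    A i = k -> A i' = k' ->
    rho + i%:R * alpha - k%:~R < h%:~R - j%:R * alpha <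
      rho + i'%:R * alpha - k'%:~R ->
  mkseq (fun l => s (i + l)%N) N != mkseq (fun l => s (i' + l)%N) N.
Proof.
move=> hA le_jN Ai Ai' /andP[lt_i lt_i'].
apply/eqP => /(mkseq_eq_height hA le_jN) A_eq.
have /andP[le_A _] := hA.1 (i + j)%N; have /andP[_ le_A'] := hA.1 (i' + j)%N.
rewrite !natrD in le_A le_A'.
have /[!ltr_int] : (A (i + j)%N - A i)%:~R < h%:~R :> R.
  by rewrite intrB Ai; lra.
have /[!ltr_int] : h%:~R < (A (i' + j)%N - A i' + 1)%:~R :> R.
  by rewrite intrD intrB Ai'; lra.
by lia.
Qed.

(** Provides the gap just to the right of a separating point, free of other separating points and
    capped by [b]. *)
Lemma next_above (R : realType) (P : seq R) (p b : R) :
    p < b ->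
  exists2 e : R, p < e <= b & forall q, q \in P -> p < q -> e <= q.
Proof.
move=> pb; elim: P => [|q P [e /andP[pe eb] eP]]; first by exists b; rewrite ?pb /=.
have [pq|qp] := ltP p q.
  exists (Num.min e q); first by rewrite lt_min pe pq ge_min eb.
  move=> r; rewrite inE => /predU1P[-> _|rP pr]; rewrite ge_min ?lexx ?orbT //.
  by rewrite eP.
exists e; first by rewrite pe eb.
by move=> r; rewrite inE => /predU1P[->|/eP//]; rewrite ltNge qp.
Qed.

(** * Counting distinct abelian squares of one length *)

Lemma as_count_ge (s : nat -> letter) (N : nat) (J : {set 'I_N})
    (i : 'I_N -> nat) :
    {in J, forall j, abelian_square (mkseq (fun l => s (i j + l)%N) N)} ->
    {in J &, injective (fun j => mkseq (fun l => s (i j + l)%N) N)} ->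
  (#|J| <= as_count s N)%N.
Proof.
move=> sq inj_i; pose w j : N.-tuple letter :=
  map_tuple (fun l => s (i j + l)%N) (iota_tuple N 0).
rewrite -(@card_in_imset _ _ w); last first.
  by move=> j j' jJ j'J /(congr1 val); apply: inj_i.
rewrite /as_count; apply: subset_leq_card; apply/fintype.subsetP.
move=> _ /imsetP[j jJ ->]; rewrite inE; apply/asboolP.
by split; [exists (i j); rewrite size_mkseq | apply: sq].
Qed.

Lemma as_count_linear (R : realType) (alpha rho : R) (s : nat -> letter)
    (A : nat -> int) (L m : nat) (M : int) :
    irrational alpha -> height alpha rho s A -> (0 < L)%N ->
    (forall x : R, exists (i : nat) (k : int),
      (i < L)%N /\ 0 < x + i%:R * alpha - k%:~R < 1 / 4) ->
    (0 < m)%N -> 0 < m%:R * alpha - M%:~R < 1 / 4 ->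
  (m.*2 %/ L <= as_count s m.*2)%N.
Proof.
move=> irr hA L_gt0 return_L m_gt0 /andP[M_lt lt_M].
(* p j is the fractional part of - j alpha. *)
pose h (j : nat) : int := - Num.floor (- (j%:R * alpha)).
pose p (j : nat) : R := (h j)%:~R - j%:R * alpha.
set N := m.*2; pose good j := 0 < p j < 1 / 4.
pose J := [set j : 'I_N | good j].
have p_inj : injective p.
  have p_neq j j' : (j < j')%N -> p j <> p j'.
    move=> lt_jj'; rewrite /p => p_eq.
    have /eqP[] := @irrational_neq_frac _ _ (h j' - h j) (j' - j) irr
      ltac:(by rewrite subn_gt0).
    by rewrite natrB ?intrB 1?ltnW // mulrBl; lra.
  by move=> j j' p_eq; case: (ltngtP j j') => // /p_neq[].
have J_card : (N %/ L <= #|J|)%N.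
  have blocks t : exists2 j, (t * L <= j < t.+1 * L)%N & (1 <= good j)%N.
    (* Since [p] runs along [- j * alpha], forward steps lower [j]. Starting from the last index of
       the block, fewer than [L] steps stay inside it. *)
    have [i [k [lt_iL /andP[k_lt lt_k]]]] := return_L (- ((t * L + L.-1)%:R * alpha)).
    exists (t * L + (L.-1 - i))%N; first by rewrite mulSn; apply/andP; lia.
    rewrite lt0b /good /p.
    have e : (t * L + L.-1)%:R = (t * L + (L.-1 - i))%:R + i%:R :> R.
      by rewrite -natrD; congr _%:R; lia.
    have -> : h (t * L + (L.-1 - i))%N = - k.
      rewrite /h; congr (- _); apply: floor_def; rewrite intrD.
      by rewrite e in k_lt lt_k; apply/andP; split; lra.
    by rewrite intrN; rewrite e in k_lt lt_k; apply/andP; split; lra.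
  have := sum_block_lower_bound (N %/ L) blocks.
  rewrite sum_nat_const_nat subn0 muln1 => /leq_trans; apply.
  have le_N : (N %/ L * L <= N)%N by rewrite leq_divM.
  rewrite cardsE -sum1_card [leqRHS]big_mkcond /=.
  rewrite -(big_mkord xpredT (fun j => if good j then 1%N else 0%N)).
  rewrite [leqRHS](@big_cat_nat _ _ _ (N %/ L * L)) //=.
  by rewrite -[leqLHS]addn0 leq_add.
have start_point (j : 'I_N) : exists i : nat, j \in J -> exists k : int,
    p j < rho + i%:R * alpha - k%:~R < 1 / 4 /\
    forall q : 'I_N, p j < p q -> rho + i%:R * alpha - k%:~R < p q.
  (* Outside [J] the start is the dummy value 0. Inside, the orbit of [rho] is dense enough to hit
     the gap between [p j] and the next separating point or [1 / 4]. *)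
  have [|] := boolP (j \in J); last by exists 0%N.
  rewrite inE => /andP[p_gt0 p_lt].
  have [e /andP[pe e_le] eP] := next_above [seq p q | q : 'I_N] p_lt.
  have [L' _ /(_ rho)[i [k [_ /andP[lt1 lt2]]]]] := rotation_bounded_return irr pe.
  exists i => _; exists k; split; first by rewrite lt1 (lt_le_trans lt2 e_le).
  move=> q /(eP _ (map_f (fun q : 'I_N => p q) (mem_enum 'I_N q))).
  exact: lt_le_trans.
have [i iP] := choice start_point.
apply: leq_trans J_card _; apply: (as_count_ge (i := i)).
- move=> j jJ; have [k [/andP[p_lt lt_p] _]] := iP j jJ.
  move: jJ; rewrite inE => /andP[p_gt0 _].
  apply: (height_abelian_square hA) => //.
  (* The start and the shift by [m] each have fractional part below [1 / 4], so after two shifts the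
     total is below [3 / 4]: no carry occurs and each half gains exactly [M]. *)
  have -> : A (i j) = k by apply: (height_eq hA); apply/andP; split; lra.
  have -> : A (i j + m)%N = k + M.
    by apply: (height_eq hA); rewrite natrD intrD; apply/andP; split; lra.
  have -> : A (i j + m.*2)%N = k + M + M.
    apply: (height_eq hA); rewrite -addnn !natrD !intrD.
    by apply/andP; split; lra.
  by ring.
- move=> j j' jJ j'J words_eq; apply: val_inj; apply: p_inj => /=.
  wlog lt_pp' : j j' jJ j'J words_eq / p j < p j'.
    move=> wl; case: (ltgtP (p j) (p j')) => [||//] lt_pp'; first exact: wl.
    by apply/esym/wl.
  (* The point [p j'] separates the two starts: that of [j] lies in the gap before it, that of [j']
     to its right. *)
  have [k [/andP[p_lt lt_p] /(_ _ lt_pp') lt_p']] := iP j jJ.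
  have [k' [/andP[p_lt' lt_p'4] _]] := iP j' j'J.
  move: jJ j'J; rewrite !inE => /andP[? ?] /andP[? ?].
  have A_i : A (i j) = k by apply: (height_eq hA); apply/andP; split; lra.
  have A_i' : A (i j') = k' by apply: (height_eq hA); apply/andP; split; lra.
  have := height_separated hA (ltnW (ltn_ord j')) A_i A_i' (h := h j').
  by rewrite words_eq eqxx lt_p' p_lt' => /(_ isT).
Qed.

(** * The quadratic lower bound *)

(** Covers small [n], where the block estimate [T * T.-1] may vanish. The square is [bb] if
    [alpha < 1 / 2] (start in [(0, 1 - 2 alpha)]) and [aa] if [alpha > 1 / 2] (start in
    [(2 - 2 alpha, 1)]). *)
Lemma as_count2_gt0 (R : realType) (alpha rho : R) (s : nat -> letter)
    (A : nat -> int) :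
    0 < alpha < 1 -> irrational alpha -> height alpha rho s A ->
  (0 < as_count s 2)%N.
Proof.
move=> /andP[a_gt0 a_lt1] irr hA.
suff [i sq] : exists i, A (i + 2)%N - A (i + 1)%N = A (i + 1)%N - A i.
  have := @as_count_ge s 2 [set ord0] (fun=> i).
  rewrite cards1; apply => [j _|j j' /set1P-> /set1P-> //].
  exact: (height_abelian_square (m := 1) hA).
have a_neq : 2%:R * alpha != 1 by exact: (irrational_neq_frac 1 (b := 2)).
case: (ltgtP (2%:R * alpha) 1) a_neq => // a_half _.
- have [L _ /(_ rho)[i [k [_ /andP[? ?]]]]] :=
    @rotation_bounded_return _ _ 0 (1 - 2%:R * alpha) irr ltac:(lra).
  have A_eq (m : nat) : (m <= 2)%N -> A (i + m)%N = k.
    move=> m_le2; have m_le : m%:R * alpha <= 2%:R * alpha.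
      by rewrite ler_wpM2r ?ler_nat ?ltW.
    have m_ge : 0 <= m%:R * alpha by rewrite mulr_ge0 // ltW.
    by apply: (height_eq hA); rewrite natrD; apply/andP; split; lra.
  by exists i; rewrite -[in A i](addn0 i) !A_eq.
- have [L _ /(_ rho)[i [k [_ /andP[? ?]]]]] :=
    @rotation_bounded_return _ _ (2 - 2%:R * alpha) 1 irr ltac:(lra).
  exists i.
  have -> : A i = k by apply: (height_eq hA); apply/andP; split; lra.
  have -> : A (i + 1)%N = k + 1.
    by apply: (height_eq hA); rewrite natrD intrD; apply/andP; split; lra.
  have -> : A (i + 2)%N = k + 2.
    by apply: (height_eq hA); rewrite natrD intrD; apply/andP; split; lra.
  by ring.
Qed.

(** The window [[t L, (t + 1) L)] contains an [m] with [{m alpha} < 1 / 4], which gives at least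
    [2 t] abelian squares of length [2 m]. Summing [2 t] over [t < T] gives [T (T - 1)]. *)
Lemma sum_as_count_quadratic (R : realType) (alpha rho : R)
    (s : nat -> letter) (A : nat -> int) (L T n : nat) :
    irrational alpha -> height alpha rho s A -> (0 < L)%N ->
    (forall x : R, exists (i : nat) (k : int),
      (i < L)%N /\ 0 < x + i%:R * alpha - k%:~R < 1 / 4) ->
    ((T * L).*2 <= n.+1)%N ->
  (T * T.-1 <= \sum_(1 <= m < n.+1) as_count s m)%N.
Proof.
move=> irr hA L_gt0 return_L le_n.
have blocks t : exists2 m, (t * L <= m < t.+1 * L)%N &
    (t.*2 <= as_count s m.*2)%N.
  have [i [k [lt_iL lt_k]]] := return_L ((t * L)%:R * alpha).
  exists (t * L + i)%N; first by rewrite mulSn; apply/andP; lia.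
  rewrite -mulrDl -natrD in lt_k.
  (* For [t = 0] the claim is trivial, and [m] might be 0 there. *)
  case: t lt_k => [//|t] lt_k.
  have m_gt0 : (0 < t.+1 * L + i)%N by rewrite mulSn; lia.
  apply: leq_trans (as_count_linear irr hA L_gt0 return_L m_gt0 lt_k).
  by rewrite leq_divRL // -doubleMl leq_double leq_addr.
have TT : (T * T.-1 = \sum_(0 <= t < T) t.*2)%N.
  elim: (T) => [|t IH]; first by rewrite big_geq.
  by rewrite big_nat_recr //= -IH; case: (t) => //= u; nia.
have as0 : as_count s 0 = 0%N.
  apply/eqP; rewrite cards_eq0; apply/eqP/setP => w; rewrite !inE.
  by apply/asboolP => -[_ [u [v [_ + _]]]]; rewrite tuple0.
rewrite TT; apply: leq_trans (sum_block_lower_bound T blocks) _.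
apply: leq_trans (sum_even_le _ _) _.
apply: (@leq_trans (\sum_(0 <= m < n.+1) as_count s m)).
  by rewrite [leqRHS](@big_cat_nat _ _ _ (T * L).*2) //= leq_addr.
by rewrite big_ltn // as0.
Qed.

Theorem theorem18 (R : realType) (alpha : R) (s : nat -> letter)
    (alpha_gt0 : 0 < alpha) (alpha_lt1 : alpha < 1)
    (alpha_irrational : irrational alpha)
    (alpha_bounded : bounded_partial_quotients alpha)
    (s_sturmian : sturmian_of_angle alpha s) :
  exists C : R, 0 < C /\
    forall n : nat, (2 <= n)%N ->
      C * n%:R ^+ 2 <= (\sum_(1 <= m < n.+1) as_count s m)%:R.
Proof.
have alpha01 : 0 < alpha < 1 by apply/andP.
have [rho [A hA]] := sturmian_height alpha01 s_sturmian.
have [L L_gt0 return_L] :=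
  @rotation_bounded_return _ _ 0 (1 / 4) alpha_irrational ltac:(lra).
(* With [d = 2 L] and [T = (n + 1) %/ d], one has [n <= (T + 1) d]. Since [S >= 1] and
   [S >= T (T - 1)], also [(T + 1) ^ 2 <= 16 S], so [n ^ 2 <= 16 d ^ 2 S]. *)
pose D := (16 * L.*2 ^ 2)%N.
have D_gt0 : 0 < D%:R :> R by rewrite ltr0n muln_gt0 expn_gt0 double_gt0 L_gt0.
exists D%:R^-1; split=> [|n n_ge2]; first by rewrite invr_gt0.
rewrite mulrC ler_pdivrMr // -natrX -natrM ler_nat.
set T := (n.+1 %/ L.*2)%N; set S := (\sum_(_ <= _ < _) _)%N.
have le_TL : ((T * L).*2 <= n.+1)%N by rewrite doubleMr leq_divM.
have le_S : (T * T.-1 <= S)%N.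
  exact: sum_as_count_quadratic alpha_irrational hA L_gt0 return_L le_TL.
have S_gt0 : (0 < S)%N.
  rewrite /S (bigD1_seq 2%N) ?mem_index_iota ?iota_uniq //=.
  by rewrite ltn_addr // (as_count2_gt0 alpha01 alpha_irrational hA).
have d_gt0 : (0 < L.*2)%N by rewrite double_gt0.
have := ltn_ceil n.+1 d_gt0.
rewrite -/T /D; set d := L.*2 => lt_n.
have le_n : (n <= T.+1 * d)%N by lia.
have le_T : (T.+1 ^ 2 <= 16 * S)%N by nia.
apply: (@leq_trans ((T.+1 * d) ^ 2)); first by rewrite leq_sqr.
by rewrite expnMn mulnA (mulnC S) leq_mul2r le_T orbT.
Qed.
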